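(* Let $\mathcal{H}$ be a finite-dimensional complex Hilbert space and let $\rho,\sigma$ be density operators on $\mathcal{H}$ with $\sigma$ invertible. For every $\epsilon$ with $0<\epsilon<1$, $$\lim_{n\to\infty}\frac1n\log\beta_n^*(\epsilon)=-D(\rho\|\sigma),$$ where $$\beta_n^*(\epsilon):=\min\{\beta_n(A^n)\mid 0\le A^n\le \mathrm{I},\ \alpha_n(A^n)\le\epsilon\},$$ the minimum being over operators $A^n$ on $\mathcal{H}^{\otimes n}$.
   Context: A density operator (state) is a positive semidefinite operator of trace one. $\rho^{\otimes n}$ is the $n$-fold tensor power of $\rho$ acting on $\mathcal{H}^{\otimes n}$. $D(\rho\|\sigma)=\operatorname{Tr}\rho(\log\rho-\log\sigma)$ is the quantum relative entropy (natural logarithm, with the convention $0\log 0=0$). For an operator $A^n$ on $\mathcal{H}^{\otimes n}$ with $0\le A^n\le \mathrm{I}$ (a test), the error probabilities of the first and second kind are $\alpha_n(A^n)=\operatorname{Tr}\rho^{\otimes n}(\mathrm{I}-A^n)$ and $\beta_n(A^n)=\operatorname{Tr}\sigma^{\otimes n}A^n$. *)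

(* Defs.v *)
From HB Require Import structures.
From mathcomp Require Import all_boot all_order all_algebra.
From mathcomp Require Import spectral complex.
From mathcomp Require mxtens.
From mathcomp Require Import all_classical all_reals all_analysis.

Set Implicit Arguments.
Unset Strict Implicit.
Unset Printing Implicit Defensive.

Import Order.TTheory GRing.Theory Num.Theory.
Import numFieldNormedType.Exports.

Local Open Scope classical_set_scope.
Local Open Scope ring_scope.
Local Open Scope sesquilinear_scope.
Local Open Scope complex_scope.

(* Operators on C^d, where C = R[i], are represented by their matrices in the
   standard orthonormal basis; (C^d)^{(x) n} is C^(d ^ n) and the n-fold tensor
   power of operators is the iterated Kronecker product [mxtens.ntensmx]. *)

Definition psdmx (R : realType) (n : nat) (A : 'M[R[i]]_n) : Prop :=
  A \is hermsymmx /\ forall v : 'cV[R[i]]_n, 0 <= (v^t* *m A *m v) 0 0.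

Definition is_density (R : realType) (d : nat) (rho : 'M[R[i]]_d) : Prop :=
  psdmx rho /\ \tr rho = 1.

Definition is_test (R : realType) (n : nat) (A : 'M[R[i]]_n) : Prop :=
  psdmx A /\ psdmx (1%:M - A).

(* Functional calculus on A = P^-1 diag(lambda) P, meant for positive
   semidefinite A.  As [ln 0 = 0], the kernel of A is sent to 0, which
   implements the convention 0 log 0 = 0 in [A *m lnmx A]. *)
Definition lnmx (R : realType) (d : nat) (A : 'M[R[i]]_d) : 'M[R[i]]_d :=
  invmx (spectralmx A)
  *m diag_mx (map_mx (fun z => (ln (complex.Re z))%:C) (spectral_diag A))
  *m spectralmx A.

(* In this definition and in the two error probabilities, the trace is a real
   number for Hermitian arguments; [complex.Re] only moves it from R[i] to R. *)
Definition relative_entropy (R : realType) (d : nat)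
    (rho sigma : 'M[R[i]]_d) : R :=
  complex.Re (\tr (rho *m (lnmx rho - lnmx sigma))).

Definition alpha (R : realType) (d : nat) (rho : 'M[R[i]]_d) (n : nat)
    (A : 'M[R[i]]_(d ^ n)) : R :=
  complex.Re (\tr (mxtens.ntensmx rho n *m (1%:M - A))).

Definition beta (R : realType) (d : nat) (sigma : 'M[R[i]]_d) (n : nat)
    (A : 'M[R[i]]_(d ^ n)) : R :=
  complex.Re (\tr (mxtens.ntensmx sigma n *m A)).

Definition beta_set (R : realType) (d : nat) (rho sigma : 'M[R[i]]_d)
    (eps : R) (n : nat) : set R :=
  [set beta sigma A | A in
     [set A : 'M[R[i]]_(d ^ n) | is_test A /\ alpha rho A <= eps]].

Definition is_minimum (R : realType) (E : set R) (m : R) : Prop :=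
  E m /\ lbound E m.

(* The minimum of [beta_set], when it is attained. *)
Definition beta_star (R : realType) (d : nat) (rho sigma : 'M[R[i]]_d)
    (eps : R) (n : nat) : R :=
  inf (beta_set rho sigma eps n).

(* Main.v *)
(* Write rho = sum_i r_i |e_i><e_i| and sigma = sum_j s_j |f_j><f_j|.  Under the
   joint distribution p(i,j) = r_i |<e_i|f_j>|^2 the mean of ln r_i - ln s_j is
   D(rho||sigma), and p is multiplicative in tensor powers, so the classical
   Chernoff bound applies to both logarithms.

   Converse (Nussbaum-Szkola).  As A^2 <= A and (1-A)^2 <= 1-A,
     Tr rho (1-A) + l Tr sigma A
       >= sum_ij r_i |<e_i|1-A|f_j>|^2 + l s_j |<e_i|A|f_j>|^2.
   The two amplitudes add up to <e_i|f_j>, so where l s_j >= K r_i the summand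
   is at least K/(K+1) p(i,j).  With l = exp(n(D + 2 delta)) and
   K = exp(n delta) those pairs carry almost all the mass, which forces
   l beta >= 1 - eps - o(1), for every eps < 1.

   Direct part.  Truncate the typical e_i (r_i >= a) to the typical f_j
   (s_j <= b) and let A project onto their span.  Its rank is at most 1/a and it
   lives where sigma <= b, so beta <= b/a; and alpha is at most the mass of the
   atypical i plus the mass of the atypical j. *)
Require Import Defs.
From HB Require Import structures.
From mathcomp Require Import all_boot all_order all_algebra.
From mathcomp Require Import spectral complex.
From mathcomp Require Import all_classical all_reals all_analysis.
From mathcomp Require Import ring lra.

Set Implicit Arguments.
Unset Strict Implicit.
Unset Printing Implicit Defensive.

Import Order.TTheory GRing.Theory Num.Theory.
Import numFieldNormedType.Exports.

Local Open Scope classical_set_scope.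
Local Open Scope ring_scope.
Local Open Scope sesquilinear_scope.
Local Open Scope complex_scope.

(** * Words over the alphabet ['I_d] *)

(** The recursion starts at one letter because [d ^ 1] reduces to [d], not to [d * 1]: the last
    letter is the remaining index itself. *)
Fixpoint digit_rec (d n : nat) : 'I_(d ^ n.+1) -> nat -> 'I_d :=
  if n is n'.+1 return 'I_(d ^ n.+1) -> nat -> 'I_d then
    fun I k => if k is k'.+1
      then digit_rec (mxtens.mxtens_unindex (I : 'I_(d * d ^ n'.+1))).2 k'
      else (mxtens.mxtens_unindex (I : 'I_(d * d ^ n'.+1))).1
  else fun I _ => I.

Definition digit (d n : nat) : 'I_(d ^ n) -> 'I_n -> 'I_d :=
  if n is n'.+1 return 'I_(d ^ n) -> 'I_n -> 'I_d
  then fun I k => digit_rec I k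
  else fun _ k => False_rect _ (notF (ltn_ord k)).

(** This entrywise form is what makes products, adjoints and diagonal matrices compatible with
    Kronecker powers. *)
Lemma ntensmx_digit (K : comPzRingType) (d n : nat) (A : 'M[K]_d)
    (I J : 'I_(d ^ n)) :
  mxtens.ntensmx A n I J = \prod_(k < n) A (digit I k) (digit J k).
Proof.
case: n I J => [|n] I J.
  by rewrite big_ord0 mxtens.ntensmx0 mxE ord1 [J]ord1 eqxx.
rewrite /digit /=; elim: n I J => [|n IHn] I J.
  by rewrite big_ord1 mxtens.ntensmx1.
by rewrite mxtens.ntensmxSS big_ord_recl /= mxE IHn.
Qed.

(** Each word is listed exactly once, so this is the distributive law. It yields the normalisation
    and the marginals of product distributions. *)
Lemma sum_prod_digit (K : comPzRingType) (d n : nat)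
    (F : 'I_n -> 'I_d -> K) :
  \sum_(I < d ^ n) \prod_(k < n) F k (digit I k) =
  \prod_(k < n) \sum_(i < d) F k i.
Proof.
case: n F => [|n] F.
  by rewrite big_ord0 (eq_bigr (fun=> 1)) ?big_ord1// => I _; rewrite big_ord0.
rewrite /digit; elim: n F => [|n IHn] F.
  by rewrite big_ord1; apply: eq_bigr => I _; rewrite big_ord1.
rewrite [RHS]big_ord_recl -(IHn (fun k => F (lift ord0 k))) mxtens.mulr_sum.
by apply: eq_bigr => I _; rewrite big_ord_recl.
Qed.

Lemma sum2_prod_digit (K : comPzRingType) (d n : nat)
    (F : 'I_d -> 'I_d -> K) :
  \sum_(I < d ^ n) \sum_(J < d ^ n) \prod_(k < n) F (digit I k) (digit J k) =
  (\sum_i \sum_j F i j) ^+ n.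
Proof.
under eq_bigr => I _ do rewrite (sum_prod_digit (fun k => F (digit I k))).
by rewrite (sum_prod_digit (fun k i => \sum_j F i j)) prodr_const card_ord.
Qed.

Lemma ntensmx_mul (K : comPzRingType) (d n : nat) (A B : 'M[K]_d) :
  mxtens.ntensmx (A *m B) n = mxtens.ntensmx A n *m mxtens.ntensmx B n.
Proof.
apply/matrixP => I J; rewrite ntensmx_digit mxE.
under eq_bigr => k _ do rewrite mxE.
rewrite -(sum_prod_digit (fun k i => A (digit I k) i * B i (digit J k))).
by apply: eq_bigr => L _; rewrite !ntensmx_digit big_split.
Qed.

Lemma ntensmx_1 (K : comPzRingType) (d n : nat) :
  mxtens.ntensmx (1%:M : 'M[K]_d) n = 1%:M.
Proof.
case: n => // n; elim: n => // n IHn; rewrite mxtens.ntensmxSS IHn.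
apply/matrixP => /= I J.
case: (mxtens.mxtens_indexP I) => i I'; case: (mxtens.mxtens_indexP J) => j J'.
rewrite mxtens.tensmxE !mxE.
rewrite (inj_eq (can_inj (@mxtens.mxtens_indexK _ _))).
by rewrite xpair_eqE -mulnb natrM.
Qed.

Lemma ntensmx_adjoint (K : numClosedFieldType) (d n : nat) (A : 'M[K]_d) :
  mxtens.ntensmx (A^t*) n = (mxtens.ntensmx A n)^t*.
Proof.
apply/matrixP => I J; rewrite !mxE !ntensmx_digit rmorph_prod.
by apply: eq_bigr => k _; rewrite !mxE.
Qed.

Lemma ntensmx_unitary (K : numClosedFieldType) (d n : nat) (A : 'M[K]_d) :
  A \is unitarymx -> mxtens.ntensmx A n \is unitarymx.
Proof.
move=> /unitarymxP A1; apply/unitarymxP.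
by rewrite -ntensmx_adjoint -ntensmx_mul A1 ntensmx_1.
Qed.

(** * Positive matrices and diagonal forms *)

(** Squared modulus, valued in [R] rather than [R[i]] so that joint probabilities are real
    numbers. *)
Definition sqnorm (R : realType) (z : R[i]) : R :=
  complex.Re z ^+ 2 + complex.Im z ^+ 2.

Definition dmx (R : realType) (n : nat) (r : 'I_n -> R) : 'M[R[i]]_n :=
  diag_mx (\row_i (r i)%:C).

Lemma sqnormE (R : realType) (z : R[i]) : (sqnorm z)%:C = z * Num.conj z.
Proof. by rewrite /sqnorm add_Re2_Im2 normCK. Qed.

Lemma sqnorm_ge0 (R : realType) (z : R[i]) : 0 <= sqnorm z.
Proof. by rewrite addr_ge0 ?sqr_ge0. Qed.

Lemma sqnorm_prod (R : realType) (I : finType) (z : I -> R[i]) :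
  sqnorm (\prod_i z i) = \prod_i sqnorm (z i).
Proof.
apply: (@complexI R); rewrite sqnormE !rmorph_prod -big_split.
by apply: eq_bigr => i _; rewrite [RHS]sqnormE.
Qed.

Lemma ReC (R : realType) (x : R) : complex.Re x%:C = x.
Proof. by []. Qed.

Lemma ReD (R : realType) (x y : R[i]) :
  complex.Re (x + y) = complex.Re x + complex.Re y.
Proof. by case: x; case: y. Qed.

Lemma ReB (R : realType) (x y : R[i]) :
  complex.Re (x - y) = complex.Re x - complex.Re y.
Proof. by case: x; case: y. Qed.

Lemma Re_ge0 (R : realType) (x : R[i]) : 0 <= x -> 0 <= complex.Re x.
Proof. by rewrite lecE => /andP[]. Qed.

Lemma mulmx_adjointE (R : realType) (m n : nat) (X : 'M[R[i]]_(m, n)) i :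
  (X *m X^t*) i i = (\sum_j sqnorm (X i j))%:C.
Proof.
rewrite mxE rmorph_sum; apply: eq_bigr => j _.
by rewrite !mxE [RHS]sqnormE.
Qed.

Lemma mxtrace_dmxl (R : realType) (n : nat) (r : 'I_n -> R) (X : 'M[R[i]]_n) :
  \tr (dmx r *m X) = \sum_i (r i)%:C * X i i.
Proof.
by rewrite /mxtrace; apply: eq_bigr => i _; rewrite mul_diag_mx !mxE.
Qed.

Lemma adjoint_mul (C : numClosedFieldType) (m n p : nat) (A : 'M[C]_(m, n))
    (B : 'M[C]_(n, p)) : (A *m B)^t* = B^t* *m A^t*.
Proof. by rewrite trmx_mul map_mxM. Qed.

Lemma adjointD (C : numClosedFieldType) (m n : nat) (A B : 'M[C]_(m, n)) :
  (A + B)^t* = A^t* + B^t*.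
Proof. by rewrite linearD map_mxD. Qed.

Lemma adjointB (C : numClosedFieldType) (m n : nat) (A B : 'M[C]_(m, n)) :
  (A - B)^t* = A^t* - B^t*.
Proof. by rewrite linearB map_mxB. Qed.

Lemma adjoint1 (C : numClosedFieldType) (n : nat) : (1%:M : 'M[C]_n)^t* = 1%:M.
Proof. by rewrite trmx1 map_mx1. Qed.

Lemma hermsymmxP (C : numClosedFieldType) (n : nat) (A : 'M[C]_n) :
  A \is hermsymmx <-> A^t* = A.
Proof.
split=> [/is_hermitianmxP|AE]; first by rewrite expr0 scale1r => <-.
by apply/is_hermitianmxP; rewrite expr0 scale1r AE.
Qed.

Lemma psdmx_adjoint (R : realType) (n : nat) (A : 'M[R[i]]_n) :
  psdmx A -> A^t* = A.
Proof. by case=> /hermsymmxP. Qed.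

Lemma psdmx_conj (R : realType) (m n : nat) (A : 'M[R[i]]_n)
    (X : 'M[R[i]]_(m, n)) : psdmx A -> psdmx (X *m A *m X^t*).
Proof.
move=> [/hermsymmxP Ah Apos]; split.
  by apply/hermsymmxP; rewrite !adjoint_mul trmxCK Ah mulmxA.
move=> v; have := Apos (X^t* *m v).
by rewrite adjoint_mul trmxCK !mulmxA.
Qed.

Lemma psdmx_diag_ge0 (R : realType) (n : nat) (A : 'M[R[i]]_n) i :
  psdmx A -> 0 <= A i i.
Proof.
move=> [_ /(_ (delta_mx i 0))].
by rewrite trmx_delta map_delta_mx -rowE -colE !mxE.
Qed.

Lemma psdmx1 (R : realType) (n : nat) : psdmx (1%:M : 'M[R[i]]_n).
Proof.
split; first by apply/hermsymmxP; rewrite adjoint1.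
move=> v; rewrite mulmx1 -{2}[v]trmxCK mulmx_adjointE lecR.
by rewrite sumr_ge0// => j _; exact: sqnorm_ge0.
Qed.

Lemma psdmx_gram (R : realType) (m n : nat) (X : 'M[R[i]]_(m, n)) :
  psdmx (X *m X^t*).
Proof. by have := psdmx_conj X (psdmx1 R n); rewrite mulmx1. Qed.

Lemma psdmxD (R : realType) (n : nat) (A B : 'M[R[i]]_n) :
  psdmx A -> psdmx B -> psdmx (A + B).
Proof.
move=> [/hermsymmxP Ah Apos] [/hermsymmxP Bh Bpos]; split.
  by apply/hermsymmxP; rewrite adjointD Ah Bh.
by move=> v; rewrite mulmxDr mulmxDl mxE addr_ge0.
Qed.

(* [A (1 - A) = A (1 - A) A + (1 - A) A (1 - A)] *)
Lemma test_subsqr_psd (R : realType) (n : nat) (A : 'M[R[i]]_n) :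
  is_test A -> psdmx (A - A *m A).
Proof.
move=> [A0 A1].
have -> : A - A *m A =
    A *m (1%:M - A) *m A^t* + (1%:M - A) *m A *m (1%:M - A)^t*.
  rewrite adjointB adjoint1 (psdmx_adjoint A0).
  rewrite [A *m (_ - _)]mulmxBr mulmx1 [(1%:M - _) *m A]mulmxBl mul1mx.
  by rewrite -mulmxDr [A + (1%:M - A)]addrC subrK mulmx1.
by apply: psdmxD; exact: psdmx_conj.
Qed.

Lemma psdmx_trace_ge0 (R : realType) (n : nat) (P A : 'M[R[i]]_n)
    (r : 'I_n -> R) : (forall i, 0 <= r i) -> psdmx A ->
  0 <= complex.Re (\tr (P^t* *m dmx r *m P *m A)).
Proof.
move=> r0 A0; rewrite -!mulmxA mxtrace_mulC -!mulmxA mxtrace_dmxl.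
apply: Re_ge0; apply: sumr_ge0 => i _.
rewrite mulr_ge0 ?lecR// mulmxA.
exact/psdmx_diag_ge0/psdmx_conj.
Qed.

(** Cyclicity leaves a diagonal of squared row norms. With a squared test or a projection as Gram
    matrix, error probabilities become weighted sums of squared amplitudes. *)
Lemma mxtrace_diag_gram (R : realType) (m n : nat) (P : 'M[R[i]]_n)
    (r : 'I_n -> R) (X : 'M[R[i]]_(n, m)) :
  complex.Re (\tr (P^t* *m dmx r *m P *m (X *m X^t*))) =
  \sum_i r i * \sum_j sqnorm ((P *m X) i j).
Proof.
rewrite -!mulmxA mxtrace_mulC -!mulmxA mxtrace_dmxl.
rewrite -[RHS]ReC rmorph_sum; congr complex.Re; apply: eq_bigr => i _.
by rewrite rmorphM mulmxA -adjoint_mul mulmx_adjointE.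
Qed.

Lemma sqnorm_conj (R : realType) (z : R[i]) : sqnorm (Num.conj z) = sqnorm z.
Proof. by apply: (@complexI R); rewrite !sqnormE conjCK mulrC. Qed.

Lemma psdmx_dmx_ge0 (R : realType) (n : nat) (P : 'M[R[i]]_n) (r : 'I_n -> R) :
  P \is unitarymx -> psdmx (P^t* *m dmx r *m P) -> forall i, 0 <= r i.
Proof.
move=> Pu A0 i; have := psdmx_diag_ge0 i (psdmx_conj P A0).
rewrite !mulmxA (unitarymxP Pu) mul1mx mulmxtVK// !mxE eqxx.
by move=> /Re_ge0.
Qed.

Lemma spectralmx_adjoint (C : numClosedFieldType) (n : nat) (A : 'M[C]_n) :
  invmx (spectralmx A) = (spectralmx A)^t*.
Proof. exact/invmx_unitary/spectral_unitarymx. Qed.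

Lemma hermitian_spectral (C : numClosedFieldType) (n : nat) (A : 'M[C]_n) :
  A \is hermsymmx ->
  A = (spectralmx A)^t* *m diag_mx (spectral_diag A) *m spectralmx A.
Proof.
move=> Ah; rewrite -spectralmx_adjoint.
exact/orthomx_spectralP/hermitian_normalmx.
Qed.

(** A Hermitian matrix has real spectrum, so [complex.Re] loses nothing. The same [P] and [r] serve
    [A] and [lnmx A], both taken from [spectralmx]. *)
Lemma psdmx_spectral (R : realType) (n : nat) (A : 'M[R[i]]_n) :
  psdmx A -> exists (P : 'M[R[i]]_n) (r : 'I_n -> R),
    [/\ P \is unitarymx, forall i, 0 <= r i, A = P^t* *m dmx r *m P &
        lnmx A = P^t* *m dmx (fun i => ln (r i)) *m P].
Proof.
move=> A0; have [Ah _] := A0.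
have Pu := spectral_unitarymx A.
have real_diag i : (complex.Re (spectral_diag A 0 i))%:C = spectral_diag A 0 i.
  apply: RRe_real; exact: (mxOverP (hermitian_spectral_diag_real Ah)).
have AE : A = (spectralmx A)^t* *m
    dmx (fun i => complex.Re (spectral_diag A 0 i)) *m spectralmx A.
  suff -> : dmx (fun i => complex.Re (spectral_diag A 0 i)) =
      diag_mx (spectral_diag A) by exact: hermitian_spectral.
  by congr diag_mx; apply/rowP => i; rewrite mxE real_diag.
exists (spectralmx A), (fun i => complex.Re (spectral_diag A 0 i)).
split; [exact: Pu | | exact: AE |].
  by apply: (psdmx_dmx_ge0 Pu); rewrite -AE.
rewrite /lnmx spectralmx_adjoint.
suff -> : map_mx (fun z => (ln (complex.Re z))%:C) (spectral_diag A) =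
    \row_i (ln (complex.Re (spectral_diag A 0 i)))%:C by [].
by apply/rowP => i; rewrite !mxE.
Qed.

(** * Overlaps of two eigenbases and the converse bound for a single test *)

Section TwoDiagonalForms.
Variables (R : realType) (n : nat) (P Q : 'M[R[i]]_n) (r s : 'I_n -> R).
Hypotheses (Pu : P \is unitarymx) (Qu : Q \is unitarymx).
Hypotheses (r0 : forall i, 0 <= r i) (s0 : forall j, 0 <= s j).

(** Row [i] of [P] is the bra of e_i and column [j] of [Q^t*] the ket of f_j, so [U i j] is the
    overlap <e_i|f_j>. *)
Let U : 'M[R[i]]_n := P *m Q^t*.
Let p i j : R := r i * sqnorm (U i j).

Lemma mxtrace_dmx_conj : \tr (P^t* *m dmx r *m P) = (\sum_i r i)%:C.
Proof.
rewrite -mulmxA mxtrace_mulC -mulmxA (unitarymxP Pu) mulmx1 mxtrace_diag.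
by rewrite rmorph_sum; apply: eq_bigr => i _; rewrite mxE.
Qed.

Lemma overlap_unitary : U \is unitarymx.
Proof. apply: (mul_unitarymx Pu); rewrite trmxC_unitary; exact: Qu. Qed.

Lemma sum_sqnorm_overlap i : \sum_j sqnorm (U i j) = 1.
Proof.
apply: (@complexI R); rewrite -mulmx_adjointE (unitarymxP overlap_unitary).
by rewrite mxE eqxx.
Qed.

Lemma mxtrace_two_dmx :
  complex.Re (\tr (P^t* *m dmx r *m P *m (Q^t* *m dmx s *m Q))) =
  \sum_i \sum_j p i j * s j.
Proof.
rewrite -!mulmxA mxtrace_mulC -!mulmxA mxtrace_dmxl.
rewrite -[RHS]ReC rmorph_sum; congr complex.Re; apply: eq_bigr => i _.
have -> : P *m (Q^t* *m (dmx s *m (Q *m P^t*))) = U *m dmx s *m U^t*.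
  by rewrite /U adjoint_mul trmxCK !mulmxA.
rewrite mxE rmorph_sum mulr_sumr; apply: eq_bigr => j _.
have -> : (U *m dmx s) i j = U i j * (s j)%:C.
  by rewrite mul_mx_diag mxE [X in _ * X]mxE.
have -> : U^t* j i = Num.conj (U i j) by rewrite mxE mxE.
by rewrite rmorphM rmorphM [X in _ = _ * X * _]sqnormE/= mulrAC !mulrA.
Qed.

(* Nussbaum-Szkola: with [x + y = u], the minimum of [r |x|^2 + l s |y|^2] is
   [r l s / (r + l s) |u|^2]. *)
Lemma test_lower_bound (A : 'M[R[i]]_n) (K l : R) : is_test A ->
    0 < K -> 0 < l ->
  K / (K + 1) * (\sum_i \sum_(j | K * r i <= l * s j) p i j) <=
  complex.Re (\tr (P^t* *m dmx r *m P *m (1%:M - A))) +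
  l * complex.Re (\tr (Q^t* *m dmx s *m Q *m A)).
Proof.
move=> At K0 l0; have [A0 A1] := At.
have D0 := test_subsqr_psd At.
(* The amplitudes <e_i|1-A|f_j> and <e_i|A|f_j>. *)
set X := P *m ((1%:M - A) *m Q^t*); set Y := P *m (A *m Q^t*).
have sqQ (B : 'M[R[i]]_n) : psdmx B -> (B *m Q^t*) *m (B *m Q^t*)^t* = B *m B.
  move=> Bpsd; rewrite adjoint_mul trmxCK (psdmx_adjoint Bpsd) mulmxA.
  by rewrite (mulmxKtV B Qu).
have alphaE : \sum_i \sum_j r i * sqnorm (X i j) <=
    complex.Re (\tr (P^t* *m dmx r *m P *m (1%:M - A))).
  have := psdmx_trace_ge0 P r0 D0.
  (* The same positive matrix controls the squares of [A] and of [1 - A]. *)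
  have -> : A - A *m A = (1%:M - A) - (1%:M - A) *m (1%:M - A).
    rewrite mulmxBl mul1mx opprB addrCA subrr addr0.
    by rewrite mulmxBr mulmx1.
  rewrite mulmxBr linearB/= ReB subr_ge0; apply: le_trans.
  rewrite -(sqQ _ A1) mxtrace_diag_gram.
  by apply: ler_sum => i _; rewrite mulr_sumr.
have betaE : \sum_i \sum_j s j * sqnorm (Y i j) <=
    complex.Re (\tr (Q^t* *m dmx s *m Q *m A)).
  have := psdmx_trace_ge0 Q s0 D0.
  rewrite mulmxBr linearB/= ReB subr_ge0; apply: le_trans.
  (* Here the square is resolved in the eigenbasis [P], opposite to the [Q] of the trace, so that
     the amplitudes are again those of [Y], conjugated. *)
  have -> : A *m A = (A *m P^t*) *m (A *m P^t*)^t*.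
    by rewrite adjoint_mul trmxCK (psdmx_adjoint A0) mulmxA (mulmxKtV A Pu).
  rewrite mxtrace_diag_gram exchange_big/=; apply: ler_sum => j _.
  rewrite mulr_sumr; apply: ler_sum => i _.
  rewrite ler_wpM2l//; suff -> : Q *m (A *m P^t*) = Y^t*.
    suff -> : Y^t* j i = Num.conj (Y i j) by rewrite sqnorm_conj.
    by rewrite mxE mxE.
  by rewrite !adjoint_mul trmxCK (psdmx_adjoint A0) mulmxA.
apply: le_trans (lerD alphaE (ler_wpM2l (ltW l0) betaE)).
rewrite !mulr_sumr -big_split; apply: ler_sum => i _ /=.
rewrite mulr_sumr mulr_sumr -big_split big_mkcond; apply: ler_sum => j _ /=.
have UE : U i j = X i j + Y i j.
  suff -> : U = X + Y by rewrite mxE.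
  by rewrite /X /Y -mulmxDr -mulmxDl subrK mul1mx.
have sqr_ge (x : R) := sqr_ge0 x.
case: ifP => [Krs|_]; last first.
  by rewrite addr_ge0// !mulr_ge0 ?sqnorm_ge0// ltW.
rewrite /p UE /sqnorm; move: (X i j) (Y i j) => [a b] [c e] /=.
have -> : K / (K + 1) * (r i * ((a + c) ^+ 2 + (b + e) ^+ 2)) =
  r i * (K / (K + 1) * ((a + c) ^+ 2 + (b + e) ^+ 2)) by ring.
(* For amplitudes x and y, (K + 1)(|x|^2 + K |y|^2) - K |x + y|^2 = |x - K y|^2. The threshold on
   [K * r i] then turns K r_i into l s_j. *)
apply: (@le_trans _ _ (r i * ((a ^+ 2 + b ^+ 2) + K * (c ^+ 2 + e ^+ 2)))).
  apply: ler_wpM2l => //.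
  have K1 : 0 < K + 1 by rewrite addr_gt0.
  rewrite mulrAC ler_pdivrMr//.
  have := sqr_ge (a - K * c); have := sqr_ge (b - K * e); nra.
have : 0 <= c ^+ 2 + e ^+ 2 by rewrite addr_ge0.
by move: Krs; set z := c ^+ 2 + e ^+ 2; nra.
Qed.

End TwoDiagonalForms.

(** * Projections as tests and the direct bound for a single test *)

Lemma psdmx_idem (R : realType) (n : nat) (A : 'M[R[i]]_n) :
  A^t* = A -> A *m A = A -> psdmx A.
Proof. by move=> Ah AA; have := psdmx_gram A; rewrite Ah AA. Qed.

(** For rectangular [G], [unitarymx] means orthonormal rows, so [G^t* *m G] projects onto their
    span. The complement is kept as a Gram matrix, ready for [mxtrace_diag_gram]. *)
Lemma unitary_compl (C : numClosedFieldType) (k n : nat) (G : 'M[C]_(k, n)) :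
  G \is unitarymx ->
  (1%:M - G^t* *m G) *m (1%:M - G^t* *m G)^t* = 1%:M - G^t* *m G.
Proof.
move=> Gu; rewrite adjointB adjoint1 adjoint_mul trmxCK.
rewrite mulmxBl mul1mx mulmxBr mulmx1 -mulmxA [G *m _]mulmxA.
by rewrite (unitarymxP Gu) mul1mx subrr subr0.
Qed.

Lemma unitary_test (R : realType) (k n : nat) (G : 'M[R[i]]_(k, n)) :
  G \is unitarymx -> is_test (G^t* *m G).
Proof.
move=> Gu; split; first by have := psdmx_gram (G^t*); rewrite trmxCK.
by rewrite -(unitary_compl Gu); exact: psdmx_gram.
Qed.

(** Conjugating the hypothesis by [X] and reading off a diagonal entry compares the two row
    norms. *)
Lemma sum_sqnorm_contract (R : realType) (m n p : nat) (X : 'M[R[i]]_(m, n))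
    (F : 'M[R[i]]_(n, p)) i : psdmx (1%:M - F *m F^t*) ->
  \sum_j sqnorm ((X *m F) i j) <= \sum_j sqnorm (X i j).
Proof.
move=> /(psdmx_conj X)/(psdmx_diag_ge0 i); rewrite mulmxBr mulmx1 mulmxBl.
rewrite mxE [X in _ + X]mxE !mulmxA -mulmxA -adjoint_mul !mulmx_adjointE.
by rewrite -rmorphB ler0c subr_ge0.
Qed.

Lemma sum_sqnorm_unitary (R : realType) (m n p : nat) (X : 'M[R[i]]_(m, n))
    (Q : 'M[R[i]]_(n, p)) i : Q \is unitarymx ->
  \sum_j sqnorm ((X *m Q) i j) = \sum_j sqnorm (X i j).
Proof.
move=> /unitarymxP Qu; apply: (@complexI R); rewrite -!mulmx_adjointE.
by rewrite adjoint_mul mulmxA -[X *m Q *m _]mulmxA Qu mulmx1.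
Qed.

(* The test is the projection onto the span of the truncations to [s j <= b],
   in the eigenbasis of sigma, of the eigenvectors of rho with [a <= r i]: its
   rank is at most [1 / a], and [1 - A] only sees what truncation discards. *)
Section TypicalTest.
Variables (R : realType) (n : nat) (P Q : 'M[R[i]]_n) (r s : 'I_n -> R).
Hypotheses (Pu : P \is unitarymx) (Qu : Q \is unitarymx).
Hypothesis (r0 : forall i, 0 <= r i).
Hypothesis (r1 : \sum_i r i = 1).
Variables (a b : R).
Hypotheses (a0 : 0 < a) (b0 : 0 <= b).

Let U : 'M[R[i]]_n := P *m Q^t*.
Let p i j : R := r i * sqnorm (U i j).
Let T := [set i | a <= r i].
(** [V] is the part that truncation discards; the rows of [W] are the truncated typical eigenvectors
    in coordinates of the eigenbasis of sigma. *)
Let V : 'M[R[i]]_n := \matrix_(i, j) if s j <= b then 0 else U i j.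
Let W : 'M[R[i]]_(#|T|, n) := rowsub enum_val (U - V).
(** Orthonormalisation keeps the row space of independent rows, hence [row_base]; the number of rows
    of [B] is the rank of [W]. *)
Let B := schmidt (row_base W).

Lemma card_typical : #|T|%:R <= a^-1.
Proof.
rewrite -(ler_pM2r a0) mulVf ?gt_eqF// -[leRHS]r1 mulr_natl -sumr_const.
rewrite [leRHS](bigID (mem T))/= ler_wpDr ?sumr_ge0//.
by apply: ler_sum => i; rewrite inE.
Qed.

Lemma typical_basis_unitary : B \is unitarymx.
Proof. exact/schmidt_unitarymx/rank_leq_col. Qed.

Lemma typical_basis_eq : (B :=: W)%MS.
Proof.
exact: eqmx_trans (eqmx_schmidt_free (row_base_free W)) (eq_row_base W).
Qed.

Lemma typical_basis_supp k j : b < s j -> B k j = 0.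
Proof.
move=> bs; have /submxP[M ->] : (B <= W)%MS by rewrite typical_basis_eq.
rewrite mxE big1// => l _; rewrite [X in _ * X]mxE.
suff -> : (U - V) (enum_val l) j = 0 by rewrite mulr0.
by rewrite mxE [X in _ + X]mxE [X in _ - X]mxE leNgt bs subrr.
Qed.

Let Gu : B *m Q \is unitarymx := mul_unitarymx typical_basis_unitary Qu.
Let F : 'M[R[i]]_n := 1%:M - (B *m Q)^t* *m (B *m Q).

(** The trace weighs the squared entries of [B] by the [s i], at most [b] on its support; the total
    weight is the number of rows of [B], at most [#|T|]. *)
Lemma typical_beta :
  complex.Re (\tr (Q^t* *m dmx s *m Q *m ((B *m Q)^t* *m (B *m Q)))) <= b / a.
Proof.
have := mxtrace_diag_gram Q s ((B *m Q)^t*); rewrite trmxCK => ->.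
have -> : Q *m (B *m Q)^t* = B^t*.
  by rewrite adjoint_mul mulmxA (unitarymxP Qu) mul1mx.
have le_b i : s i * \sum_j sqnorm (B^t* i j) <= b * \sum_j sqnorm (B^t* i j).
  have [sb|bs] := leP (s i) b.
    by rewrite ler_wpM2r// sumr_ge0// => j _; exact: sqnorm_ge0.
  rewrite [X in _ * X]big1 ?mulr0 1?[X in _ * X]big1 ?mulr0// => j _;
  have -> : B^t* i j = 0 by rewrite mxE mxE typical_basis_supp// rmorph0.
    by rewrite /sqnorm /= expr0n addr0.
  by rewrite /sqnorm /= expr0n addr0.
apply: le_trans (ler_sum _ (fun i _ => le_b i)) _.
rewrite -mulr_sumr ler_wpM2l// exchange_big/=.
apply: le_trans card_typical.
rewrite (eq_bigr (fun=> 1)) => [|k _].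
  by rewrite sumr_const card_ord ler_nat rank_leq_row.
apply: (@complexI R); transitivity ((B *m B^t*) k k).
  rewrite mulmx_adjointE; congr (_%:C); apply: eq_bigr => i _.
  by rewrite mxE mxE sqnorm_conj.
by rewrite (unitarymxP typical_basis_unitary) mxE eqxx.
Qed.

Lemma typical_kernel i : i \in T ->
  forall j, ((U - V) *m Q *m F) i j = 0.
Proof.
move=> iT j.
have WF : W *m Q *m F = 0.
  have /submxP[M ->] : (W <= B)%MS by rewrite typical_basis_eq.
  have BF : B *m Q *m F = 0.
    by rewrite mulmxBr mulmx1 (mulmxA (B *m Q)) (unitarymxP Gu) mul1mx subrr.
  by rewrite -(mulmxA M B Q) -(mulmxA M (B *m Q) F) BF mulmx0.
have := congr1 (fun Z : 'M[R[i]]_(_, _) => Z (enum_rank_in iT i) j) WF.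
rewrite [RHS]mxE => <-; rewrite -!mulmxA mxE [RHS]mxE; apply: eq_bigr => k _.
by congr (_ * _); rewrite [RHS]mxE enum_rankK_in.
Qed.

(** Row by row: for atypical [i], [F] contracts a unit vector, which costs at most [r i]. For
    typical [i], [P] splits as [(U - V) *m Q + V *m Q], [F] kills the first part, and the second has
    squared norm the discarded mass. *)
Lemma typical_alpha :
  complex.Re (\tr (P^t* *m dmx r *m P *m F)) <=
  \sum_(i | r i < a) r i + \sum_i \sum_(j | b < s j) p i j.
Proof.
rewrite -(unitary_compl Gu : F *m F^t* = F) mxtrace_diag_gram.
have FF : psdmx (1%:M - F *m F^t*).
  rewrite (unitary_compl Gu) opprB addrC subrK.
  exact: (unitary_test Gu).1.
rewrite [X in _ <= X + _]big_mkcond -big_split; apply: ler_sum => i _ /=.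
have pV : \sum_(j | b < s j) p i j = r i * \sum_j sqnorm (V i j).
  rewrite big_mkcond mulr_sumr; apply: eq_bigr => j _.
  rewrite mxE leNgt; case: ifP => //=.
  by rewrite /sqnorm /= expr0n addr0 mulr0.
rewrite pV; case: ltP => [_|ari].
  apply: ler_wpDr.
    by rewrite mulr_ge0// sumr_ge0// => j _; exact: sqnorm_ge0.
  rewrite -[leRHS]mulr1 ler_wpM2l//.
  apply: le_trans (sum_sqnorm_contract _ _ FF) _.
  rewrite -lecR -mulmx_adjointE (unitarymxP Pu) mxE eqxx.
  exact: lexx.
rewrite add0r ler_wpM2l//.
rewrite -(sum_sqnorm_unitary V i Qu).
apply: le_trans (sum_sqnorm_contract _ i FF).
apply: ler_sum => j _; suff -> : (P *m F) i j = (V *m Q *m F) i j by [].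
have -> : P = (U - V) *m Q + V *m Q by rewrite -mulmxDl subrK (mulmxKtV P Qu).
by rewrite mulmxDl mxE typical_kernel ?add0r// inE.
Qed.

Lemma typical_test : exists A : 'M[R[i]]_n, [/\ is_test A,
  complex.Re (\tr (P^t* *m dmx r *m P *m (1%:M - A))) <=
    \sum_(i | r i < a) r i + \sum_i \sum_(j | b < s j) p i j &
  complex.Re (\tr (Q^t* *m dmx s *m Q *m A)) <= b / a].
Proof.
exists ((B *m Q)^t* *m (B *m Q)); split.
- exact: unitary_test Gu.
- exact: typical_alpha.
- exact: typical_beta.
Qed.

End TypicalTest.

(** * Exponential tails for products of finite distributions *)

(** From exp(-x) >= 1 - x, and (1 + x + 2 x^2)(1 - x) = 1 + x^2 (1 - 2 x). *)
Lemma expR_le_quad (R : realType) (x : R) :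
  x <= 2^-1 -> expR x <= 1 + x + 2 * x ^+ 2.
Proof.
move=> x2; have x1 : 0 < 1 - x by lra.
have e1 : 1 - x <= expR (- x) by have := expR_ge1Dx (- x).
rewrite -[x in expR x]opprK expRN.
apply: (@le_trans _ _ (1 - x)^-1); first by rewrite lef_pV2 ?posrE ?expR_gt0.
rewrite -[leLHS]mul1r ler_pdivrMr//.
have : 0 <= x ^+ 2 * (1 - 2 * x) by rewrite mulr_ge0 ?sqr_ge0//; lra.
by rewrite expr2; lra.
Qed.

(** At t = 0 the sum is 1 with negative slope [- eta]; [expR_le_quad] makes this quantitative. *)
Lemma mgf_lt1 (R : realType) (I : finType) (p X : I -> R) (c : R) :
  (forall i, 0 <= p i) -> \sum_i p i = 1 -> \sum_i p i * X i < c ->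
  exists t, 0 < t /\ \sum_i p i * expR (t * (X i - c)) < 1.
Proof.
move=> p0 p1 Xc.
pose M := 1 + \sum_i `|X i - c|; pose eta := c - \sum_i p i * X i.
have eta0 : 0 < eta by rewrite subr_gt0.
have XM i : `|X i - c| <= M.
  rewrite /M (bigD1 i)//= addrCA ler_wpDr// addr_ge0//.
  by rewrite sumr_ge0.
have M0 : 0 < M by rewrite ltr_pwDl// sumr_ge0.
have M20 : 0 < M ^+ 2 by rewrite exprn_gt0.
have etaE : \sum_i p i * (X i - c) = - eta.
  under eq_bigr do rewrite mulrBr.
  by rewrite sumrB -mulr_suml p1 mul1r opprB.
have etaM : eta <= M.
  rewrite -[eta]opprK -etaE -sumrN -[leRHS]mul1r -p1 mulr_suml.
  apply: ler_sum => i _; rewrite -mulrN ler_wpM2l//.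
  by rewrite (le_trans _ (XM i))// -normrN ler_norm.
(* The minimiser of - t eta + 2 t^2 M^2, with value - t eta / 2; [eta <= M] keeps the exponents
   within range of the quadratic bound. *)
pose t := eta / (4 * M ^+ 2).
have t0 : 0 < t by rewrite divr_gt0 ?mulr_gt0.
exists t; split=> //.
have tE : t * (4 * M ^+ 2) = eta by rewrite mulfVK// gt_eqF// mulr_gt0.
have tM : t * M <= 2^-1.
  suff : t * M * M <= 2^-1 * M by rewrite ler_pM2r.
  by rewrite -mulrA -expr2; lra.
apply: (@le_lt_trans _ _ (\sum_i p i *
    (1 + t * (X i - c) + 2 * (t * M) ^+ 2))).
  apply: ler_sum => i _; rewrite ler_wpM2l//.
  have tX : `|t * (X i - c)| <= t * M by rewrite normrM gtr0_norm// ler_pM2l.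
  apply: le_trans (expR_le_quad _) _.
    by rewrite (le_trans (ler_norm _))// (le_trans tX).
  rewrite lerD2l ler_pM2l// -[leLHS]real_normK ?num_real//.
  by rewrite lerXn2r ?nnegrE// mulr_ge0// ltW.
have -> : \sum_i p i * (1 + t * (X i - c) + 2 * (t * M) ^+ 2) =
    1 - t * eta + 2 * (t * M) ^+ 2.
  under eq_bigr do rewrite 2!mulrDr mulr1 mulrCA.
  by rewrite !big_split/= -mulr_suml p1 mul1r -mulr_sumr etaE mulrN.
have -> : 2 * (t * M) ^+ 2 = t * eta / 2 by rewrite -tE; field.
have : 0 < t * eta by rewrite mulr_gt0.
lra.
Qed.

(* The event is only compared with the tail of the sum of [X] on words of
   positive probability, so that [X] may be a logarithm with junk value
   [ln 0 = 0]. *)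
Lemma chernoff (R : realType) (d : nat) (p X : 'I_d -> 'I_d -> R) (c : R) :
    (forall i j, 0 <= p i j) -> \sum_i \sum_j p i j = 1 ->
    \sum_i \sum_j p i j * X i j < c ->
  exists q, [/\ 0 <= q, q < 1 & forall n (E : rel 'I_(d ^ n)),
    (forall I J, E I J -> (forall k, 0 < p (digit I k) (digit J k)) ->
      n%:R * c <= \sum_k X (digit I k) (digit J k)) ->
    \sum_I \sum_(J | E I J) \prod_k p (digit I k) (digit J k) <= q ^+ n].
Proof.
move=> p0 p1 Xc.
have [t [t0 mgf]] : exists t, 0 < t /\
    \sum_i \sum_j p i j * expR (t * (X i j - c)) < 1.
  have [| | |t [t0 mgf]] := @mgf_lt1 R ('I_d * 'I_d)%type
    (fun ij => p ij.1 ij.2) (fun ij => X ij.1 ij.2) c.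
  - by move=> ij.
  - by rewrite -p1 pair_big.
  - by rewrite pair_big in Xc.
  by exists t; split=> //; rewrite pair_big.
pose f i j := p i j * expR (t * (X i j - c)).
have f0 i j : 0 <= f i j by rewrite mulr_ge0// expR_ge0.
exists (\sum_i \sum_j f i j); split=> //.
  by rewrite sumr_ge0// => i _; rewrite sumr_ge0.
(* As [q ^+ n] is itself a sum over pairs of words, the comparison is termwise: on the event, either
   some factor [p] vanishes or the exponential weight is at least 1. *)
move=> n E EX; rewrite -sum2_prod_digit; apply: ler_sum => I _.
rewrite big_mkcond; apply: ler_sum => J _.
case: ifP => [/EX {}EX|_]; last by rewrite prodr_ge0.
have [pos|] := boolP [forall k, 0 < p (digit I k) (digit J k)]; last first.
  rewrite negb_forall => /existsP[k].
  rewrite lt_neqAle p0 andbT negbK => /eqP pk.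
  by rewrite (bigD1 k)//= -pk mul0r prodr_ge0.
rewrite big_split/= -[leLHS]mulr1 ler_wpM2l ?prodr_ge0//.
rewrite -expR_sum -expR0 ler_expR -mulr_sumr mulr_ge0 ?(ltW t0)//.
rewrite sumrB subr_ge0 sumr_const card_ord -mulr_natl.
by apply: EX => k; exact: (forallP pos).
Qed.

(** * The minimum is attained *)

Lemma continuous_comb (R : realType) (T : topologicalType) (a b : R)
    (f g h k : T -> R) : continuous f -> continuous g -> continuous h ->
  continuous k -> continuous (fun v => a * (f v + g v) - b * (h v - k v)).
Proof.
move=> fc gc hc kc v; apply: cvgB; apply: cvgMl_tmp.
  by apply: cvgD; [exact: fc | exact: gc].
by apply: cvgB; [exact: hc | exact: kc].
Qed.

Lemma continuous_subl (R : realType) (T : topologicalType) (a : R)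
    (f : T -> R) :
  continuous f -> continuous (fun v => a - f v).
Proof. by move=> fc v; apply: cvgB; [exact: cvg_cst | exact: fc]. Qed.

Lemma cube_compact (R : realType) (m : nat) :
  compact [set v : 'rV[R]_m | forall k, v ord0 k \in `[-1, 1]].
Proof.
exact: (@rV_compact _ m (fun=> `[(-1 : R), 1]%classic)
  (fun=> @segment_compact _ _ _)).
Qed.

(* Tests are parametrised by real coordinates, as [X + X^*] with [X] half the
   test: R[i] carries no compactness theory, but the cubes of 'rV[R]_m do. *)
Section HermitianCoordinates.
Variables (R : realType) (n : nat).
Notation coords := ('rV[R]_(n * n + n * n)).

Definition cmx (v : coords) : 'M[R[i]]_n := \matrix_(i, j)
  (v 0 (lshift _ (mxvec_index i j)) +i* v 0 (rshift _ (mxvec_index i j))).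

Definition hermx (v : coords) : 'M[R[i]]_n := cmx v + (cmx v)^t*.

Lemma hermx_adjoint v : (hermx v)^t* = hermx v.
Proof. by rewrite adjointD trmxCK addrC. Qed.

Lemma ReM (x y : R[i]) : complex.Re (x * y) =
  complex.Re x * complex.Re y - complex.Im x * complex.Im y.
Proof. by case: x; case: y. Qed.

Lemma Re_sum (I : finType) (F : I -> R[i]) :
  complex.Re (\sum_i F i) = \sum_i complex.Re (F i).
Proof. by apply: (big_morph _ (@ReD R)). Qed.

Lemma Re_mxtrace_hermx_continuous (B : 'M[R[i]]_n) :
  continuous (fun v : coords => complex.Re (\tr (B *m hermx v))).
Proof.
have coordc k : continuous (fun v : coords => v 0 k).
  exact: coord_continuous.
have -> : (fun v : coords => complex.Re (\tr (B *m hermx v))) =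
    (fun v : coords => \sum_i \sum_k
      (complex.Re (B i k) * (v 0 (lshift _ (mxvec_index k i)) +
                             v 0 (lshift _ (mxvec_index i k))) -
       complex.Im (B i k) * (v 0 (rshift _ (mxvec_index k i)) -
                             v 0 (rshift _ (mxvec_index i k))))).
  apply/funext => v; rewrite /mxtrace Re_sum; apply: eq_bigr => i _.
  rewrite mxE Re_sum; apply: eq_bigr => k _.
  by rewrite ReM !mxE.
apply: continuous_big => [|i _]; first exact: add_continuous.
apply: continuous_big => [|k _]; first exact: add_continuous.
exact: continuous_comb.
Qed.

Lemma Re_mxtrace_compl_hermx_continuous (B : 'M[R[i]]_n) :
  continuous (fun v : coords => complex.Re (\tr (B *m (1%:M - hermx v)))).
Proof.
have -> : (fun v : coords => complex.Re (\tr (B *m (1%:M - hermx v)))) =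
    (fun v : coords => complex.Re (\tr B) - complex.Re (\tr (B *m hermx v))).
  by apply/funext => v; rewrite mulmxBr mulmx1 linearB ReB.
exact/continuous_subl/Re_mxtrace_hermx_continuous.
Qed.

(** Positivity is an intersection of closed conditions, one for each vector. The family [L] is
    general so as to cover both a test and its complement. *)
Lemma closed_psdmx_continuous (L : coords -> 'M[R[i]]_n) :
  (forall v, (L v)^t* = L v) ->
  (forall B, continuous (fun v => complex.Re (\tr (B *m L v)))) ->
  closed [set v | psdmx (L v)].
Proof.
move=> Lh Lc.
have -> : [set v | psdmx (L v)] = \bigcap_(w in [set: 'cV[R[i]]_n])
    [set v | 0 <= complex.Re (\tr ((w *m w^t*) *m L v))].
  apply/seteqP; split=> v /=.
    move=> [_ Lpos] w _ /=; rewrite -mulmxA mxtrace_mulC.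
    by rewrite /mxtrace big_ord1; apply: Re_ge0.
  move=> Lpos; split; first exact/hermsymmxP.
  move=> w; have /= := Lpos w I; rewrite -mulmxA mxtrace_mulC.
  rewrite /mxtrace big_ord1; set q := _ *m _ *m _ => q0.
  (* The quadratic form is a Hermitian 1 x 1 matrix, hence real, so its real part decides its
     sign. *)
  have qh : q^t* = q by rewrite /q !adjoint_mul trmxCK Lh mulmxA.
  have : q 0 0 \is Num.real.
    apply/CrealP; transitivity (q^t* 0 0); last by rewrite qh.
    by rewrite [RHS]mxE [X in _ = _ X]mxE.
  by move=> qr; rewrite -(RRe_real qr) ler0c; exact: q0.
apply: closed_bigI => u _.
apply: (@preimage_closed _ _ (fun v => complex.Re (\tr ((u *m u^t*) *m L v)))
  [set x | 0 <= x]); last exact: closed_ge.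
by move=> v _; exact: Lc.
Qed.

(** The bound holds since |A_ij|^2 is at most the [i]-th diagonal entry of A^2, which is at most
    A_ii <= 1. *)
Lemma hermx_surj (A : 'M[R[i]]_n) : is_test A ->
  exists2 v : coords, hermx v = A & forall k, v 0 k \in `[-1, 1].
Proof.
move=> At; have [A0 A1] := At.
have Ah := psdmx_adjoint A0.
pose v : coords := row_mx (mxvec (\matrix_(i, j) (complex.Re (A i j) / 2)))
                          (mxvec (\matrix_(i, j) (complex.Im (A i j) / 2))).
have vE : cmx v = 2^-1 *: A.
  apply/matrixP => i j; rewrite mxE row_mxEl row_mxEr !mxvecE !mxE.
  have -> : 2^-1 = (2^-1 : R)%:C :> R[i] by rewrite fmorphV rmorph_nat.
  by case: (A i j) => a b /=; simpc; rewrite mulrC [b * _]mulrC.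
exists v.
  rewrite /hermx vE linearZ map_mxZ Ah /= fmorphV rmorph_nat -scalerDl.
  by rewrite -[_^-1 + _]mulr2n -[_ *+ 2]mulr_natr mulVf ?scale1r// pnatr_eq0.
have Asq i j : sqnorm (A i j) <= 1.
  have := psdmx_diag_ge0 i (test_subsqr_psd At).
  rewrite mxE [X in _ + X]mxE -{3}Ah mulmx_adjointE => /Re_ge0.
  rewrite ReB ReC subr_ge0 => sqA.
  have := psdmx_diag_ge0 i A1; rewrite !mxE eqxx => /Re_ge0.
  rewrite ReB subr_ge0 => /(le_trans sqA); apply: le_trans.
  by rewrite (bigD1 j)//= ler_wpDr// sumr_ge0// => k _; exact: sqnorm_ge0.
have sq_half (x y : R) : x ^+ 2 + y ^+ 2 <= 1 -> -1 <= x / 2 <= 1.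
  by move=> xy; have := sqr_ge0 y; have := sqr_ge0 (x - 1);
    have := sqr_ge0 (x + 1); move=> *; apply/andP; split; nra.
move=> k; rewrite in_itv/=; case: (split_ordP k) => l ->.
  rewrite row_mxEl; case/mxvec_indexP: l => i j; rewrite mxvecE mxE.
  exact: sq_half (Asq i j).
rewrite row_mxEr; case/mxvec_indexP: l => i j; rewrite mxvecE mxE.
by apply: (@sq_half _ (complex.Re (A i j))); rewrite addrC; exact: Asq.
Qed.

End HermitianCoordinates.

(** Extreme value theorem: the admissible coordinates form a closed part of a compact cube, and
    [beta] is continuous in them. *)
Lemma beta_set_minimum (R : realType) (d : nat) (rho sigma : 'M[R[i]]_d)
    (eps : R) (n : nat) : 0 <= eps ->
  is_minimum (beta_set rho sigma eps n) (beta_star rho sigma eps n).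
Proof.
move=> eps0.
pose coords := 'rV[R]_(d ^ n * d ^ n + d ^ n * d ^ n).
pose cube : set coords := [set v | forall k, v ord0 k \in `[-1, 1]].
pose K : set coords := cube `&`
  ([set v : coords | is_test (hermx v)] `&`
   [set v : coords | alpha rho (hermx v) <= eps]).
have Kcompact : compact K.
  apply: (@subclosed_compact _ K cube) => [||v []//]; last exact: cube_compact.
  apply: closedI.
    apply: (@compact_closed _ cube); first exact: norm_hausdorff.
    exact: cube_compact.
  apply: closedI.
    apply: closedI.
      apply: closed_psdmx_continuous => [v|B]; first exact: hermx_adjoint.
      exact: Re_mxtrace_hermx_continuous.
    apply: (@closed_psdmx_continuous _ _ (fun v => 1%:M - hermx v)) => [v|B].
      by rewrite adjointB adjoint1 hermx_adjoint.
    exact: Re_mxtrace_compl_hermx_continuous.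
  apply: (@preimage_closed _ _ (fun v : coords => alpha rho (hermx v))
    [set x | x <= eps]); last exact: closed_le.
  by move=> v _; exact: Re_mxtrace_compl_hermx_continuous.
have [||v] := @compact_EVT_min _ R
    (fun v : coords => beta sigma (hermx v)) K _ Kcompact.
(* The identity is admissible: its first-kind error is 0. *)
- have [|v v1 vcube] := @hermx_surj R (d ^ n) 1%:M.
    split; first exact: psdmx1.
    by rewrite subrr; apply: psdmx_idem; rewrite ?mulmx0// trmx0 map_mx0.
  exists v; split=> //; rewrite /= v1.
  split; last by rewrite /alpha subrr mulmx0 mxtrace0.
  split; first exact: psdmx1.
  by rewrite subrr; apply: psdmx_idem; rewrite ?mulmx0// trmx0 map_mx0.
- by apply: continuous_subspaceT; exact: Re_mxtrace_hermx_continuous.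
rewrite inE => -[vcube [vtest valpha]] vmin.
have Ev : beta_set rho sigma eps n (beta sigma (hermx v)).
  by exists (hermx v).
have lbv : lbound (beta_set rho sigma eps n) (beta sigma (hermx v)).
  move=> _ [A [At Aa] <-]; have [w wA wcube] := hermx_surj At.
  by rewrite -wA; apply: vmin; rewrite inE /K /= wA.
suff -> : beta_star rho sigma eps n = beta sigma (hermx v) by [].
apply/eqP; rewrite eq_le; apply/andP; split.
  by apply: ge_inf => //; exists (beta sigma (hermx v)).
by apply: lb_le_inf => //; exists (beta sigma (hermx v)).
Qed.

(** * Independent copies *)

Lemma ntensmx_dmx (R : realType) (d n : nat) (r : 'I_d -> R) :
  mxtens.ntensmx (dmx r) n = dmx (fun I => \prod_k r (digit I k)).
Proof.
apply/matrixP => I J; rewrite ntensmx_digit !mxE -mulr_natr.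
(* Equality of words becomes a product over letters because the identity is a Kronecker power of the
   identity. *)
have -> : (I == J)%:R = mxtens.ntensmx (1%:M : 'M[R[i]]_d) n I J.
  by rewrite ntensmx_1 mxE.
rewrite ntensmx_digit rmorph_prod -big_split; apply: eq_bigr => k _ /=.
by rewrite !mxE mulr_natr.
Qed.

(** Puts [n] copies in the diagonal form used for single tests, with products of eigenvalues indexed
    by words. *)
Lemma ntensmx_spectral (R : realType) (d n : nat) (P : 'M[R[i]]_d)
    (r : 'I_d -> R) :
  mxtens.ntensmx (P^t* *m dmx r *m P) n =
  (mxtens.ntensmx P n)^t* *m dmx (fun I => \prod_k r (digit I k))
    *m mxtens.ntensmx P n.
Proof. by rewrite !ntensmx_mul ntensmx_adjoint ntensmx_dmx. Qed.

Lemma near_geometric_le (R : realType) (q e : R) : 0 <= q -> q < 1 -> 0 < e ->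
  \forall n \near \oo, q ^+ n <= e.
Proof.
move=> q0 q1 e0.
have : (GRing.exp q : R ^nat) x @[x --> \oo] --> 0.
  by apply: cvg_expr; rewrite ger0_norm.
move=> /cvgrPdist_le /(_ _ e0); apply: filterS => n.
by rewrite sub0r normrN ger0_norm// exprn_ge0.
Qed.

(** * Converse and direct bounds for [n] copies *)

Section Stein.
Variables (R : realType) (d : nat) (P Q : 'M[R[i]]_d) (r s : 'I_d -> R).
Hypotheses (Pu : P \is unitarymx) (Qu : Q \is unitarymx).
Hypotheses (r0 : forall i, 0 <= r i) (r1 : \sum_i r i = 1).
Hypotheses (s0 : forall j, 0 < s j).

Let U : 'M[R[i]]_d := P *m Q^t*.
Let p i j : R := r i * sqnorm (U i j).
Let rho := P^t* *m dmx r *m P.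
Let sigma := Q^t* *m dmx s *m Q.
Let Elnr := \sum_i \sum_j p i j * ln (r i).
Let Elns := \sum_i \sum_j p i j * ln (s j).

Lemma joint_ge0 i j : 0 <= p i j.
Proof. by rewrite mulr_ge0// sqnorm_ge0. Qed.

Lemma joint_marginal i : \sum_j p i j = r i.
Proof. by rewrite -mulr_sumr (sum_sqnorm_overlap Pu Qu) mulr1. Qed.

Lemma joint_sum1 : \sum_i \sum_j p i j = 1.
Proof. by under eq_bigr do rewrite joint_marginal. Qed.

(** Pairs of positive weight never meet the junk value [ln 0]. *)
Lemma joint_gt0 i j : 0 < p i j -> 0 < r i.
Proof.
by rewrite lt_def joint_ge0 andbT mulf_eq0 negb_or => /andP[rN0 _];
  rewrite lt_def rN0 r0.
Qed.

Lemma joint_prod n (I J : 'I_(d ^ n)) :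
  (\prod_k r (digit I k)) *
    sqnorm ((mxtens.ntensmx P n *m (mxtens.ntensmx Q n)^t*) I J) =
  \prod_k p (digit I k) (digit J k).
Proof.
by rewrite -ntensmx_adjoint -ntensmx_mul ntensmx_digit sqnorm_prod -big_split.
Qed.

Lemma ln_prod_digit n (z : 'I_d -> R) (I : 'I_(d ^ n)) :
  (forall k, 0 < z (digit I k)) ->
  \prod_k z (digit I k) = expR (\sum_k ln (z (digit I k))).
Proof.
by move=> z0; rewrite expR_sum; apply: eq_bigr => k _; rewrite lnK ?posrE.
Qed.

(** The rate [q] comes from the tail of the log-likelihood ratio alone, so it is uniform in [n] and
    in the test. *)
Lemma stein_converse (delta : R) : 0 < delta ->
  exists q, [/\ 0 <= q, q < 1 & forall n (A : 'M[R[i]]_(d ^ n)), is_test A ->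
    1 - expR (- (n%:R * delta)) - q ^+ n - alpha rho A <=
    expR (n%:R * (Elnr - Elns + 2 * delta)) * beta sigma A].
Proof.
move=> delta0.
have [|q [q0 q1 tail]] := @chernoff R d p (fun i j => ln (r i) - ln (s j))
  (Elnr - Elns + delta) joint_ge0 joint_sum1.
  suff -> : \sum_i \sum_j p i j * (ln (r i) - ln (s j)) = Elnr - Elns.
    by rewrite ltrDl.
  rewrite -sumrB; apply: eq_bigr => i _; rewrite -sumrB.
  by apply: eq_bigr => j _; rewrite mulrBr.
exists q; split=> // n A At.
pose K := expR (n%:R * delta).
pose l := expR (n%:R * (Elnr - Elns + 2 * delta)).
have K0 : 0 < K := expR_gt0 _; have l0 : 0 < l := expR_gt0 _.
pose rn (I : 'I_(d ^ n)) := \prod_k r (digit I k).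
pose sn (I : 'I_(d ^ n)) := \prod_k s (digit I k).
have rn0 I : 0 <= rn I by rewrite prodr_ge0.
have sn0 I : 0 <= sn I by rewrite prodr_ge0// => k _; rewrite ltW.
have := test_lower_bound (ntensmx_unitary n Pu) (ntensmx_unitary n Qu)
  rn0 sn0 At K0 l0.
rewrite -!ntensmx_spectral -/rho -/sigma.
rewrite -[complex.Re _]/(alpha rho A) -[X in _ + l * X]/(beta sigma A).
set S := \sum_I _ => SK.
pose pn (I J : 'I_(d ^ n)) := \prod_k p (digit I k) (digit J k).
have SE : S = \sum_I \sum_(J | K * rn I <= l * sn J) pn I J.
  by apply: eq_bigr => I _; apply: eq_bigr => J _; rewrite /rn joint_prod.
have pn0 I J : 0 <= pn I J by rewrite prodr_ge0// => k _; exact: joint_ge0.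
have S0 : 0 <= S.
  by rewrite SE sumr_ge0// => I _; rewrite sumr_ge0.
have total : S + \sum_I \sum_(J | ~~ (K * rn I <= l * sn J)) pn I J = 1.
  rewrite SE -big_split/= -(expr1n _ n) -joint_sum1 -sum2_prod_digit.
  apply: eq_bigr => I _.
  by rewrite [RHS](bigID (fun J => K * rn I <= l * sn J)).
have Stail : \sum_I \sum_(J | ~~ (K * rn I <= l * sn J)) pn I J <= q ^+ n.
  apply: (tail n (fun I J => ~~ (K * rn I <= l * sn J))) => I J.
  (* In logarithms, l s < K r says that the sum of ln r - ln s exceeds n (Elnr - Elns + delta). *)
  rewrite -ltNge /rn /sn => lK ppos.
  move: lK; rewrite ln_prod_digit; last by move=> k.
  rewrite ln_prod_digit; last by move=> k; apply: joint_gt0 (ppos k).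
  by rewrite -!expRD ltr_expR sumrB; lra.
have S1 : S <= 1.
  rewrite -total lerDl sumr_ge0// => I _; rewrite sumr_ge0//.
(* Here [K^-1] is the exponential, and (1 - 1/K)(K + 1) = K - 1/K. *)
have KE : 1 - expR (- (n%:R * delta)) <= K / (K + 1).
  rewrite ler_pdivlMr ?addr_gt0// expRN -/K mulrBl mul1r mulrDr mulVf ?gt_eqF//.
  have Kinv0 : 0 < K^-1 by rewrite invr_gt0.
  lra.
have e0 : 0 < expR (- (n%:R * delta)) := expR_gt0 _.
have : (1 - expR (- (n%:R * delta))) * S <= K / (K + 1) * S.
  by rewrite ler_wpM2r.
rewrite -/l; move: SK; set KS := K / (K + 1) * S.
have : expR (- (n%:R * delta)) * S <= expR (- (n%:R * delta)).
  by rewrite ler_piMr// ltW.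
rewrite mulrBl mul1r; lra.
Qed.

(** The two rates bound the masses of small rho-eigenvalues and of large sigma-eigenvalues, each
    logarithm being allowed a deviation [delta] from its mean. *)
Lemma stein_direct (delta : R) : 0 < delta ->
  exists q1 q2, [/\ 0 <= q1 < 1, 0 <= q2 < 1 & forall n,
    exists A : 'M[R[i]]_(d ^ n), [/\ is_test A,
      alpha rho A <= q1 ^+ n + q2 ^+ n &
      beta sigma A <= expR (- (n%:R * (Elnr - Elns - 2 * delta)))]].
Proof.
move=> delta0.
have [|q1 [q10 q11 tail1]] := @chernoff R d p (fun i j => - ln (r i))
  (- Elnr + delta) joint_ge0 joint_sum1.
  suff -> : \sum_i \sum_j p i j * - ln (r i) = - Elnr by rewrite ltrDl.
  rewrite -sumrN; apply: eq_bigr => i _; rewrite -sumrN.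
  by apply: eq_bigr => j _; rewrite mulrN.
have [|q2 [q20 q21 tail2]] := @chernoff R d p (fun i j => ln (s j))
  (Elns + delta) joint_ge0 joint_sum1.
  by rewrite ltrDl.
exists q1, q2; split; [by rewrite q10 q11 | by rewrite q20 q21 | move=> n].
(* With a = exp(n (Elnr - delta)) and b = exp(n (Elns + delta)), b / a is exactly the claimed bound
   on [beta]. *)
pose a := expR (- (n%:R * (- Elnr + delta))).
pose b := expR (n%:R * (Elns + delta)).
pose rn (I : 'I_(d ^ n)) := \prod_k r (digit I k).
pose sn (I : 'I_(d ^ n)) := \prod_k s (digit I k).
pose pn (I J : 'I_(d ^ n)) := \prod_k p (digit I k) (digit J k).
have rn0 I : 0 <= rn I by rewrite prodr_ge0.
have sn0 I : 0 <= sn I by rewrite prodr_ge0// => k _; rewrite ltW.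
have rn1 : \sum_I rn I = 1.
  by rewrite (sum_prod_digit (fun=> r)) r1 prodr_const expr1n.
have [A [At Aalpha Abeta]] := typical_test sn (ntensmx_unitary n Pu)
  (ntensmx_unitary n Qu) rn0 rn1 (expR_gt0 _ : 0 < a) (expR_ge0 _ : 0 <= b).
exists A; move: Aalpha Abeta; rewrite -!ntensmx_spectral => Aalpha Abeta.
split; first exact: At.
  apply: le_trans Aalpha _; apply: lerD.
    (* As a marginal of the joint distribution, the mass of atypical [I] falls under the same tail
       bound. *)
    have pnE I : rn I = \sum_J pn I J.
      rewrite /pn (sum_prod_digit (fun k => p (digit I k))).
      by apply: eq_bigr => k _; rewrite joint_marginal.
    apply: le_trans (tail1 n (fun I _ => rn I < a) _) => [|I J].
      rewrite big_mkcond; apply: ler_sum => I _.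
      by case: ifP => _; rewrite ?pnE// big_pred0.
    move=> ra ppos; move: ra; rewrite /rn ln_prod_digit.
      by rewrite ltr_expR sumrN; lra.
    by move=> k; apply: joint_gt0 (ppos k).
  apply: le_trans (tail2 n (fun _ J => b < sn J) _) => [|I J].
    by apply: ler_sum => I _; apply: ler_sum => J _; rewrite /rn joint_prod.
  by rewrite /sn ln_prod_digit// ltr_expR => + _; lra.
apply: le_trans Abeta _; rewrite -expRN -expRD ler_expR; lra.
Qed.

(** For the term in [lnmx rho] both bases are [P], the overlap matrix is the identity, and the
    marginal [r i] is spread back over [p i j]. *)
Lemma relative_entropyE :
  lnmx rho = P^t* *m dmx (fun i => ln (r i)) *m P ->
  lnmx sigma = Q^t* *m dmx (fun j => ln (s j)) *m Q ->
  relative_entropy rho sigma = Elnr - Elns.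
Proof.
move=> lnr lns; rewrite /relative_entropy mulmxBr linearB ReB lnr lns.
rewrite !mxtrace_two_dmx; congr (_ - _).
apply: eq_bigr => i _; rewrite (bigD1 i)//= big1 ?addr0 => [|j ji].
  rewrite -mulr_suml joint_marginal (unitarymxP Pu) mxE eqxx.
  by rewrite /sqnorm /= expr1n expr0n addr0 mulr1.
rewrite (unitarymxP Pu) mxE eq_sym (negbTE ji).
by rewrite /sqnorm /= expr0n addr0 mulr0 mul0r.
Qed.

End Stein.

(** * Spectral data of the two states and passage to the limit *)

Lemma invertible_spectrum_neq0 (R : realType) (n : nat) (Q : 'M[R[i]]_n)
    (s : 'I_n -> R) :
  Q \is unitarymx -> Q^t* *m dmx s *m Q \in unitmx -> forall j, s j != 0.
Proof.
move=> Qu; rewrite !unitmx_mul => /andP[/andP[_ su] _] j.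
move: su; rewrite unitmxE det_diag unitfE prodf_seq_neq0 => /allP/(_ j).
rewrite mem_index_enum mxE -(rmorph0 (real_complex R)).
by rewrite (inj_eq (@complexI R)) => /(_ isT).
Qed.

Lemma density_spectral (R : realType) (d : nat) (rho : 'M[R[i]]_d) :
  is_density rho -> exists (P : 'M[R[i]]_d) (r : 'I_d -> R),
    [/\ P \is unitarymx, forall i, 0 <= r i, \sum_i r i = 1,
        rho = P^t* *m dmx r *m P &
        lnmx rho = P^t* *m dmx (fun i => ln (r i)) *m P].
Proof.
move=> [/psdmx_spectral[P [r [Pu r0 rhoE lnE]]] tr1]; exists P, r; split=> //.
apply: (@complexI R); rewrite -(mxtrace_dmx_conj r Pu) -rhoE tr1.
by rewrite rmorph1.
Qed.

Local Close Scope complex_scope.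
Local Close Scope sesquilinear_scope.

Theorem theorem1 (R : realType) (d : nat) (rho sigma : 'M[R[i]]_d)
    (hrho : is_density rho) (hsigma : is_density sigma)
    (hinv : sigma \in unitmx) (eps : R) (heps0 : 0 < eps) (heps1 : eps < 1) :
  (forall n : nat,
     is_minimum (beta_set rho sigma eps n) (beta_star rho sigma eps n)) /\
  (n%:R^-1 * ln (beta_star rho sigma eps n)) @[n --> \oo]
    --> - relative_entropy rho sigma.
Proof.
have minE n := beta_set_minimum rho sigma n (ltW heps0).
split=> //.
have [P [r [Pu r0 r1 rhoE lnr]]] := density_spectral hrho.
have [Q [s [Qu s0 _ sigmaE lns]]] := density_spectral hsigma.
(* Invertibility of sigma makes every [ln (s j)] a genuine logarithm. *)
have {}s0 j : 0 < s j.
  rewrite lt_def s0 andbT; apply: (invertible_spectrum_neq0 Qu).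
  by rewrite -sigmaE.
have := @relative_entropyE _ _ _ _ r s Pu Qu.
rewrite -rhoE -sigmaE => /(_ lnr lns) DE.
set D := relative_entropy rho sigma in DE *; clearbody D.
apply/cvgrPdist_le => e e0.
(* Two thirds of [e] go to the [2 * delta] of both bounds, one third to the vanishing term ln eta /
   n. *)
have [delta delta0 deltaE] : exists2 delta, 0 < delta & e = 3 * delta.
  by exists (e / 3); [rewrite divr_gt0 | field].
have [q [q0 q1]] := stein_converse Pu Qu r0 r1 s0 delta0.
rewrite -rhoE -sigmaE -DE => converse.
have [qr [qs [/andP[qr0 qr1] /andP[qs0 qs1]]]] :=
  stein_direct Pu Qu r0 r1 s0 delta0.
rewrite -rhoE -sigmaE -DE => direct.
clear DE r1.
(* Each error term of the converse is eventually at most [eta / 2], which leaves 1 - eps - eta =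
   eta. *)
have [eta eta0 etaE] : exists2 eta, 0 < eta & 1 - eps = 2 * eta.
  by exists ((1 - eps) / 2); [rewrite divr_gt0// subr_gt0 | field].
have eta20 : 0 < eta / 2 by rewrite divr_gt0.
have eps20 : 0 < eps / 2 by rewrite divr_gt0.
have edelta1 : expR (- delta) < 1 by rewrite -expR0 ltr_expR oppr_lt0.
near=> n.
have n0 : (0 < n)%N by near: n; exact: nbhs_infty_gt.
have nR0 : 0 < n%:R :> R by rewrite ltr0n.
have [[A [At Aalpha] AE] lbE] := minE n.
have eta_le : eta <= expR (n%:R * (D + 2 * delta)) * beta_star rho sigma eps n.
  have := converse n A At; rewrite AE; apply: le_trans.
  have : q ^+ n <= eta / 2 by near: n; exact: near_geometric_le.
  have : expR (- (n%:R * delta)) <= eta / 2.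
    rewrite -mulrN mulrC expRM_natr.
    by near: n; apply: near_geometric_le => //; exact: expR_ge0.
  lra.
(* The converse also shows that the minimum is positive, so its logarithm is genuine. *)
have beta0 : 0 < beta_star rho sigma eps n.
  rewrite -(pmulr_rgt0 _ (expR_gt0 (n%:R * (D + 2 * delta)))).
  exact: lt_le_trans eta0 eta_le.
have lower : ln eta - n%:R * (D + 2 * delta) <= ln (beta_star rho sigma eps n).
  rewrite -ler_expR expRD lnK ?posrE// lnK ?posrE// expRN.
  rewrite ler_pdivrMr ?expR_gt0//.
  by rewrite mulrC.
have upper : ln (beta_star rho sigma eps n) <= - (n%:R * (D - 2 * delta)).
  have [B [Bt Balpha Bbeta]] := direct n.
  rewrite -ler_expR lnK ?posrE//; apply: le_trans Bbeta; apply: lbE.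
  exists B; [split; [exact: Bt |] | exact: erefl].
  (* Eventually both tails are at most [eps / 2], so the typical test competes in the minimum. *)
  apply: le_trans Balpha _.
  have : qr ^+ n <= eps / 2 by near: n; exact: near_geometric_le.
  have : qs ^+ n <= eps / 2 by near: n; exact: near_geometric_le.
  lra.
have eta_n : - ln eta <= n%:R * delta.
  rewrite -ler_pdivrMr//; near: n; exact: nbhs_infty_ger.
rewrite ler_distlC deltaE; apply/andP; split.
  rewrite ler_pdivlMl//; lra.
rewrite ler_pdivrMl//.
have : 0 < n%:R * delta by rewrite mulr_gt0.
lra.
Unshelve. all: by end_near.
Qed.
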